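(* Let $r\ge5$ be an odd integer. Then every $r$-regular graph admits a $1$-sum $3$-flow. Moreover, every $2$-edge-connected $r$-regular graph admits a $1$-sum $2$-flow.
   Context: For a positive integer $k$ and a real $c$, a $c$-sum $k$-flow on a graph $G=(V,E)$ is a function $\omega:E\to\{\pm1,\ldots,\pm(k-1)\}$ such that $\sum_{e\ni v}\omega(e)=c$ for every vertex $v$. (So a $1$-sum $2$-flow uses only values $\pm1$, and a $1$-sum $3$-flow uses values in $\{\pm1,\pm2\}$.) *)

(* Defs.v *)
From mathcomp Require Import all_boot all_order all_algebra.

Set Implicit Arguments.
Unset Strict Implicit.
Unset Printing Implicit Defensive.

Import GRing.Theory Num.Theory.

(* Finite loopless graphs, parallel edges allowed; a simple graph is one whose
   [ends] is injective. Incidence of e and v is [v \in ends e]. *)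
Record graph := Graph {
  vertex : finType;
  edge : finType;
  ends : edge -> {set vertex};
  card_ends : forall e, #|ends e| = 2
}.

Definition degree (G : graph) (v : vertex G) : nat :=
  #|[set e : edge G | v \in ends e]|.

Definition regular (r : nat) (G : graph) : Prop :=
  forall v : vertex G, degree v = r.

(* Adjacency in G - F. *)
Definition adj_del (G : graph) (F : {set edge G}) : rel (vertex G) :=
  [rel x y | [exists e, (e \notin F) && (ends e == [set x; y])]].

Definition connected_del (G : graph) (F : {set edge G}) : Prop :=
  forall x y : vertex G, connect (adj_del F) x y.

Definition edge_connected (k : nat) (G : graph) : Prop :=
  1 < #|vertex G| /\
  forall F : {set edge G}, #|F| < k -> connected_del F.

(* The sums are integers, so c is taken in int: for non-integral c no graph
   with a vertex has a c-sum flow. *)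
Definition sum_flow (c : int) (k : nat) (G : graph) (w : edge G -> int) : Prop :=
  (forall e, 0 < absz (w e) < k) /\
  (forall v, (\sum_(e : edge G | v \in ends e) w e)%R = c).

Definition admits_sum_flow (c : int) (k : nat) (G : graph) : Prop :=
  exists w : edge G -> int, sum_flow c k w.

(* Main.v *)
Require Import Defs.
From mathcomp Require Import all_boot all_order all_algebra.
From mathcomp Require Import zify.

Set Implicit Arguments.
Unset Strict Implicit.
Unset Printing Implicit Defensive.

(* Let k be the even number among (r - 1) / 2 and (r + 1) / 2, and s = 2 k - r,
   so s = 1 or s = -1. A k-factor F gives the 1-sum 2-flow s (2 [F] - 1), and
   edge sets F1, F3 with 3 deg_F1 = deg_F3 + 2 k at every vertex give the 1-sum
   3-flow s (3 [F1] - [F3] - 1).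

   A graph without cuts of size at most 1, with degrees r except at one vertex,
   has a factor with even degrees proportional to the degrees of the graph, up
   to rounding at the exceptional vertex, as long as 3 kap <= 2 r for the degree
   kap (Gallai). This follows from Tutte's 1-factor theorem applied to the usual
   gadget graph, because the constant weight kap / r satisfies the odd cut
   inequalities. In particular a 2-edge-connected graph has a k-factor.

   In general, the minimal nonempty vertex sets left by at most one edge (the
   leaves) are disjoint by uncrossing. Contracting all of them to one vertex
   leaves no small cut, which yields F0 with degree k outside the leaves. In a
   leaf whose outgoing edge is not in F0, take F1 = F3 = a k-factor; otherwise
   take F1 and F3 with degrees k + 1 and k + 3. *)

(** * Hall's and Tutte's theorems *)

Section Hall.
Variables (A B : finType) (R : A -> B -> bool) (b0 : B).

Definition neighbours (Y : {set B}) (S : {set A}) : {set B} :=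
  [set b in Y | [exists a in S, R a b]].

(** Induction on [#|S|]. If a nonempty proper subset [S'] is tight, match [S'] first and then the
    rest into [Y] without the neighbours of [S']. Otherwise every such subset has a surplus
    neighbour, so one vertex [a] can be matched to any of its neighbours. The default [b0] is the
    value of [h] for empty [S]. *)
Lemma hall (S : {set A}) (Y : {set B}) :
    (forall S' : {set A}, S' \subset S -> #|S'| <= #|neighbours Y S'|) ->
  exists h : A -> B,
    {in S &, injective h} /\ {in S, forall a, R a (h a) && (h a \in Y)}.
Proof.
have [n] := ubnP #|S|; elim: n S Y => // n IHn S Y leSn hallS.
have [->|[a aS]] := set_0Vmem S.
  by exists (fun=> b0); split=> [a a'|a]; rewrite inE.
case: (boolP [exists S' : {set A}, [&& S' \proper S, S' != set0 &
         #|neighbours Y S'| <= #|S'|]]).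
  case/existsP=> S' /and3P[ltS'S nzS' tightS'].
  have sS'S := proper_sub ltS'S.
  have [||h1 [inj1 h1P]] := IHn S' Y.
  - by apply: leq_trans (proper_card ltS'S) _; rewrite -ltnS.
  - by move=> S2 sS2; apply: hallS; apply: subset_trans sS2 sS'S.
  have [||h2 [inj2 h2P]] := IHn (S :\: S') (Y :\: neighbours Y S').
  - by have := cardsDS sS'S; have := subset_leq_card sS'S; rewrite -card_gt0 in nzS'; lia.
  - move=> S2; rewrite subsetD => /andP[sS2S dS2S'].
    have /hallS : S' :|: S2 \subset S by rewrite subUset sS'S.
    rewrite cardsU setIC (disjoint_setI0 dS2S') cards0 subn0 => le1.
    have : neighbours Y (S' :|: S2) \subset
           neighbours Y S' :|: neighbours (Y :\: neighbours Y S') S2.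
      apply/subsetP=> b; rewrite !inE => /andP[bY /existsP[x]].
      rewrite inE bY /= => /andP[/orP[xS|xS] Rxb].
        by apply/orP; left; apply/existsP; exists x; rewrite xS.
      case: existsP => //= _; apply/existsP; exists x; by rewrite xS.
    move/subset_leq_card; rewrite cardsU; lia.
  exists (fun x => if x \in S' then h1 x else h2 x); split=> [x y|x] xS; last first.
    case: ifP => xS'; first exact: h1P.
    have /h2P/andP[-> /setDP[->]] // : x \in S :\: S' by rewrite inE xS'.
  have sep u v : u \in S' -> v \in S -> v \notin S' -> h1 u <> h2 v.
    move=> uS' vS vS' eq12.
    have /h2P/andP[_ /setDP[_ /negP]] : v \in S :\: S' by rewrite inE vS'.
    case/andP: (h1P _ uS') => Ruh h1Y; case; rewrite -eq12 inE h1Y /=.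
    by apply/existsP; exists u; rewrite uS'.
  move=> yS; case: ifPn => xS'; case: ifPn => yS'.
  - exact: inj1.
  - by move/sep => /(_ xS' yS yS').
  - by move/esym/sep => /(_ yS' xS xS').
  - by apply: inj2; rewrite inE ?xS' ?yS'.
move/existsPn=> surplus.
have : 0 < #|neighbours Y [set a]|.
  by apply: leq_trans (hallS _ _); rewrite ?cards1 // sub1set.
case/card_gt0P=> b; rewrite inE => /andP[bY /existsP[a' /andP[/set1P-> Rab]]].
have [||h [injh hP]] := IHn (S :\ a) (Y :\ b).
- by have := cardsD1 a S; rewrite aS; lia.
- move=> S' /subsetD1P[sS'S aS'].
  have [->|nzS'] := eqVneq S' set0; first by rewrite cards0.
  have := surplus S'; rewrite nzS' /= negb_and -ltnNge properE sS'S /= negbK.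
  have /negPf-> /= : ~~ (S \subset S') by apply/subsetPn; exists a.
  move=> lt1.
  have : neighbours Y S' \subset b |: neighbours (Y :\ b) S'.
    apply/subsetP=> c; rewrite !inE => /andP[-> ->].
    by case: eqVneq.
  move/subset_leq_card; have := cardsU1 b (neighbours (Y :\ b) S').
  case: (b \notin _) => /=; lia.
exists (fun x => if x == a then b else h x); split=> [x y|x] xS; last first.
  case: eqVneq => [->|xa]; first by rewrite Rab.
  by have /hP/andP[-> /setD1P[_ ->]] : x \in S :\ a by rewrite !inE xa.
have hb z : z \in S -> z != a -> h z != b.
  move=> zS za.
  by have /hP/andP[_ /setD1P[]] : z \in S :\ a by rewrite !inE za.
move=> yS; case: (eqVneq x a) => [->|xa]; case: (eqVneq y a) => [->|ya] //.
- by move/esym/eqP; rewrite (negPf (hb _ yS ya)).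
- by move/eqP; rewrite (negPf (hb _ xS xa)).
- by apply: injh; rewrite !inE ?xa ?ya.
Qed.

End Hall.

(** * Barriers and Tutte's 1-factor theorem *)

Section Tutte.
Variables (T : finType) (e : rel T).
Hypothesis e_sym : symmetric e.
Implicit Types (W X C : {set T}) (Q : {set {set T}}).

Definition perfect_matching W (m : T -> T) :=
  {in W, forall x, [/\ m x \in W, e x (m x) & m (m x) = x]}.

Definition closed_in W C :=
  [forall x in C, forall y in W, e x y ==> (y \in C)].

(** The members of [Q] are disjoint odd unions of components of [W :\: X] rather than components.
    Each contains an odd component, so the largest possible [#|Q|] is still the number of odd
    components. *)
Definition barrier W X Q :=
  [&& X \subset W, trivIset Q &
   [forall C in Q, [&& odd #|C|, C \subset W :\: X & closed_in (W :\: X) C]]].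

Lemma closed_inP W C :
  reflect (forall x y, x \in C -> y \in W -> e x y -> y \in C) (closed_in W C).
Proof.
apply: (iffP forall_inP) => [cl x y xC yW exy | cl x xC].
  by have /forall_inP/(_ _ yW)/implyP := cl x xC; apply.
by apply/forall_inP=> y yW; apply/implyP; apply: cl.
Qed.

Lemma barrierP W X Q :
  reflect [/\ X \subset W, trivIset Q &
    forall C, C \in Q -> [/\ odd #|C|, C \subset W :\: X & closed_in (W :\: X) C]]
   (barrier W X Q).
Proof.
apply: (iffP and3P) => -[sXW tQ QP]; split=> //.
  by move=> C CQ; apply/and3P; apply: (forall_inP QP).
by apply/forall_inP=> C CQ; apply/and3P; apply: QP.
Qed.

Lemma barrier_set0_notin W X Q : barrier W X Q -> set0 \notin Q.
Proof. by case/barrierP=> _ _ QP; apply/negP=> /QP[]; rewrite cards0. Qed.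

Lemma barrier_add W X Q C : barrier W X Q -> odd #|C| -> C \subset W :\: X ->
    closed_in (W :\: X) C -> [disjoint C & cover Q] ->
  barrier W X (C |: Q) /\ #|C |: Q| = #|Q|.+1.
Proof.
move=> bQ oC sC clC dC; have [sXW tQ QP] := barrierP _ _ _ bQ.
have [|tCQ CQ] := trivIsetU1 _ tQ (barrier_set0_notin bQ) (A := C).
  by move=> D DQ; apply: disjointWr dC; apply: bigcup_sup.
split; last by rewrite cardsU1 CQ.
by apply/barrierP; split=> // D /setU1P[->|/QP].
Qed.

Lemma barrier_rest_closed W X Q : barrier W X Q ->
  closed_in (W :\: X) ((W :\: X) :\: cover Q).
Proof.
case/barrierP=> sXW tQ QP; apply/closed_inP=> x y /setDP[xW xQ] yW exy.
rewrite inE yW andbT; apply: contra xQ => /bigcupP[C CQ yC].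
have [_ _ /closed_inP clC] := QP C CQ.
by apply/bigcupP; exists C => //; apply: clC yC xW _; rewrite e_sym.
Qed.

Lemma odd_card_barrier W X Q : barrier W X Q ->
  odd #|W| = odd #|X| (+) odd #|Q| (+) odd #|(W :\: X) :\: cover Q|.
Proof.
case/barrierP=> sXW tQ QP.
have sQW : cover Q \subset W :\: X by apply/bigcupsP=> C /QP[].
have -> : odd #|Q| = odd #|cover Q|.
  rewrite -(eqP tQ) -sum1_card; apply: (big_ind2 (fun a b => odd a = odd b)) => //.
    by move=> a b c d eab ecd; rewrite !oddD eab ecd.
  by move=> C /QP[].
have := cardsDS sXW; have := cardsDS sQW.
have := subset_leq_card sXW; have := subset_leq_card sQW; lia.
Qed.

(** If [#|Q|] exceeds [#|X|] by exactly one, then what [X] and [cover Q] leave of the even set [W]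
    is odd. It is also closed, so it can join [Q]. *)
Lemma barrier_parity W X Q : barrier W X Q -> ~~ odd #|W| -> #|X| < #|Q| ->
  exists2 Q', barrier W X Q' & #|X|.+1 < #|Q'|.
Proof.
move=> bQ evenW ltXQ.
have [ltXQ1|leQX] := ltnP #|X|.+1 #|Q|; first by exists Q.
have oR : odd #|(W :\: X) :\: cover Q| by have := odd_card_barrier bQ; lia.
have [||bQ' cQ'] := barrier_add bQ oR _ (barrier_rest_closed bQ).
- exact: subsetDl.
- by rewrite disjoints_subset subsetDr.
- by exists ((W :\: X) :\: cover Q |: Q); rewrite // cQ'; lia.
Qed.

Lemma barrier_del W X Q x : barrier W X Q ->
  barrier W (X :\ x) [set C in Q | ~~ [exists y in C, e x y]].
Proof.
case/barrierP=> sXW tQ QP; apply/barrierP; split.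
- by apply: subset_trans sXW; apply: subsetDl.
- by apply: trivIsetS tQ; apply/subsetP=> C /setIdP[].
- move=> C /setIdP[/QP[oC sC /closed_inP clC] /existsPn nadj]; split=> //.
    by apply: subset_trans sC _; apply: setDS; apply: subsetDl.
  apply/closed_inP=> y z yC; rewrite !inE negb_and negbK => /andP[/orP[/eqP->|zX] zW] eyz.
    by have := nadj y; rewrite yC e_sym eyz.
  by apply: clC yC _ eyz; rewrite inE zX.
Qed.

Lemma minimal_barrier W X Q : barrier W X Q -> ~~ odd #|W| -> #|X| < #|Q| ->
  exists X' Q', [/\ barrier W X' Q', #|X'|.+1 < #|Q'| &
    {in X', forall x, 2 < #|[set C in Q' | [exists y in C, e x y]]|}].
Proof.
move=> bQ evenW; move: {2}#|X| (leqnn #|X|) => n.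
elim: n X Q bQ => [|n IHn] X Q bQ leXn /(barrier_parity bQ evenW)[{}Q {}bQ ltXQ].
  exists X, Q; split=> // x; have/eqP-> : X == set0 by rewrite -cards_eq0; lia.
  by rewrite inE.
case: (boolP [forall x in X, 2 < #|[set C in Q | [exists y in C, e x y]]|]).
  by move/forall_inP=> minX; exists X, Q.
case/forall_inPn=> x xX; rewrite -leqNgt => le2.
have cX := cardsD1 x X; rewrite xX in cX.
apply: (IHn _ _ (barrier_del x bQ)); first by lia.
have : [set C in Q | [exists y in C, e x y]] :|:
       [set C in Q | ~~ [exists y in C, e x y]] = Q.
  by apply/setP=> C; rewrite !inE -andb_orr orbN andbT.
move/(congr1 (fun A : {set {set T}} => #|A|)) => cQ.
have := cardsU [set C in Q | [exists y in C, e x y]]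
               [set C in Q | ~~ [exists y in C, e x y]].
lia.
Qed.

Lemma perfect_matching_bigcup (I : finType) (J : {set I}) (G : I -> {set T}) :
    {in J &, forall i j, i != j -> [disjoint G i & G j]} ->
    {in J, forall i, exists m, perfect_matching (G i) m} ->
  exists m, perfect_matching (\bigcup_(i in J) G i) m.
Proof.
move=> dG exm.
have /fin_all_exists[M MP] i : exists m, i \in J -> perfect_matching (G i) m.
  case: (boolP (i \in J)) => [/exm[m]|_]; first by exists m.
  by exists id.
have uniqG i j x : i \in J -> j \in J -> x \in G i -> x \in G j -> i = j.
  move=> iJ jJ xi xj; apply/eqP/negPn/negP=> ij.
  by have /pred0P/(_ x) := dG _ _ iJ jJ ij; rewrite /= xi xj.
pose m x := if [pick i in J | x \in G i] is Some i then M i x else x.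
have mE i x : i \in J -> x \in G i -> m x = M i x.
  move=> iJ xi; rewrite /m; case: pickP => [j /andP[jJ xj]|/(_ i)].
    by rewrite (uniqG j i x).
  by rewrite iJ xi.
exists m => x /bigcupP[i iJ xi]; have [Mxi exM MK] := MP i iJ x xi.
rewrite (mE i x) // (mE i (M i x)) //; split=> //.
by apply/bigcupP; exists i.
Qed.

Lemma perfect_matching_setU2 W y x m : y \in W -> x \notin W -> e y x ->
    perfect_matching (W :\ y) m ->
  exists m', perfect_matching (x |: W) m'.
Proof.
move=> yW xW eyx mP; have yx : y != x by apply: contraNneq xW => <-.
exists (fun z => if z == x then y else if z == y then x else m z) => z.
case/setU1P=> [->|zW]; rewrite ?eqxx ?(negPf yx) ?eqxx.
  by rewrite !inE yW orbT e_sym eyx.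
have zx : z != x by apply: contraNneq xW => <-.
rewrite (negPf zx); have [->|zy] := eqVneq z y; first by rewrite setU11 eqxx.
have [|/setD1P[my mW] ezm mK] := mP z; first by rewrite !inE zy.
have /negPf-> : m z != x by apply: contraNneq xW => <-.
by rewrite (negPf my) mK !inE mW orbT.
Qed.

(* Anderson's proof of Tutte's theorem: in a maximal tight barrier (X, Q) the
   sets in Q cover W :\: X, each of them stays matchable after removal of any
   one vertex, and Hall's theorem matches Q with X. *)
Theorem tutte W :
  (forall X Q, barrier W X Q -> #|Q| <= #|X|) -> exists m, perfect_matching W m.
Proof.
have [n] := ubnP #|W|; elim: n W => // n IHn W leWn tutteW.
have [->|[w0 w0W]] := set_0Vmem W; first by exists id => x; rewrite inE.
pose P (p : {set T} * {set {set T}}) := barrier W p.1 p.2 && (#|p.1| <= #|p.2|).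
have P0 : P (set0, set0).
  rewrite /P /= !cards0 andbT; apply/barrierP; split; first exact: sub0set.
    by rewrite /trivIset /cover !big_set0 cards0.
  by move=> C; rewrite inE.
have [X [Q [bQ leXQ maxX]]] : exists X Q, [/\ barrier W X Q, #|X| <= #|Q| &
    forall X' Q', barrier W X' Q' -> #|X'| <= #|Q'| -> #|X'| <= #|X|].
  case: (arg_maxnP (fun p : {set T} * {set {set T}} => #|p.1|) P0).
  case=> X Q /andP[/= bQ leXQ] maxX; exists X, Q; split=> // X' Q' b' le'.
  by apply: (maxX (X', Q')); rewrite /P /= b'.
have [sXW tQ QP] := barrierP _ _ _ bQ.
have eqXQ : #|Q| = #|X| by have := tutteW _ _ bQ; lia.
(* An odd rest could be added to [Q], contradicting [tutteW]. From a nonempty even rest, one vertex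
   could be moved to [X] and the others added to [Q], contradicting the maximality of [X]. *)
have R0 : (W :\: X) :\: cover Q = set0.
  set R := _ :\: _; have clR := barrier_rest_closed bQ.
  have dR : [disjoint R & cover Q] by rewrite disjoints_subset subsetDr.
  have sR : R \subset W :\: X := subsetDl _ _.
  case: (boolP (odd #|R|)) => [oR|evenR].
    have [/tutteW le1 c1] := barrier_add bQ oR sR clR dR.
    by rewrite c1 eqXQ ltnn in le1.
  have [//|[v vR]] := set_0Vmem R.
  have vWX := subsetP sR v vR; have /setDP[vW vX] := vWX.
  have cR := cardsD1 v R; rewrite vR in cR.
  have bv : barrier W (v |: X) Q.
    apply/barrierP; split=> //; first by rewrite subUset sub1set vW.
    move=> C CQ; have [oC sC /closed_inP clC] := QP C CQ; split=> //.
      apply/subsetP=> z zC; have /setDP[zW zX] := subsetP sC z zC.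
      rewrite !inE negb_or zX zW !andbT; apply: contraTneq vR => <-.
      by rewrite inE negb_and negbK; apply/orP; left; apply/bigcupP; exists C.
    apply/closed_inP=> x y xC; rewrite !inE negb_or => /andP[/andP[_ yX] yW].
    by apply: clC xC _; rewrite inE yX.
  have [||||b1 c1] := barrier_add bv (C := R :\ v).
  - by move: evenR; rewrite cR add1n /= negbK.
  - apply/subsetP=> z /setD1P[zv /(subsetP sR)/setDP[zW zX]].
    by rewrite !inE negb_or zv zX.
  - apply/closed_inP=> x y /setD1P[_ xR]; rewrite !inE negb_or.
    case/andP=> /andP[yv yX] yW exy; rewrite yv /=.
    by have := closed_inP _ _ clR x y xR; rewrite !inE yX yW => /(_ isT exy).
  - by apply: disjointWl dR; apply: subsetDl.
  - have := maxX _ _ b1; rewrite c1 eqXQ cardsU1 vX add1n ltnn.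
    by move/(_ (leqnn _)).
have coverQ : cover Q = W :\: X.
  apply/eqP; rewrite eqEsubset -[(W :\: X) \subset _]setD_eq0 R0 eqxx andbT.
  by apply/bigcupsP=> C /QP[].
have critical C v : C \in Q -> v \in C -> exists m, perfect_matching (C :\ v) m.
  move=> CQ vC; have [oC sC clC] := QP C CQ.
  have cC := cardsD1 v C; rewrite vC in cC.
  have sCW : C \subset W := subset_trans sC (subsetDl _ _).
  apply: IHn => [|Y Q1 b1]; first by move: (subset_leq_card sCW) leWn cC; clear; lia.
  rewrite leqNgt; apply/negP=> /(barrier_parity b1)[|Q2 b2 lt2].
    by move: oC; rewrite cC add1n.
  have [sYC t2 Q2P] := barrierP _ _ _ b2.
  have vWX := subsetP sC v vC; have /setDP[vW vX] := vWX.
  have sYCC : Y \subset C := subset_trans sYC (subsetDl _ _).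
  have dXC : [disjoint X & C].
    rewrite disjoint_sym; apply/pred0P=> z /=; apply/negP=> /andP[zC zX].
    by have := subsetP sC z zC; rewrite inE zX.
  have sub2 D : D \in Q2 -> D \subset C.
    by case/Q2P=> _ sD _; apply: (subset_trans sD); rewrite setDDl subsetDl.
  have other D z : D \in Q :\ C -> z \in D -> z \notin C.
    move=> /setD1P[DC DQ] zD; apply/negP=> zC.
    by have /pred0P/(_ z) := trivIsetP tQ D C DQ CQ DC; rewrite /= zC zD.
  have n2 : set0 \notin Q2 := barrier_set0_notin b2.
  have d12 : [disjoint Q :\ C & Q2].
    apply/pred0P=> D /=; apply/negP=> /andP[D1 D2].
    have [D0|[z zD]] := set_0Vmem D; first by rewrite -D0 D2 in n2.
    by have := other D z D1 zD; rewrite (subsetP (sub2 D D2)).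
  (* Since [#|Q2|] is at least [#|Y| + 2], exchanging [C] for [Q2] and enlarging [X] by [v] and [Y]
     gives a larger [X] that still does not outnumber its family. *)
  have bb : barrier W (X :|: (v |: Y)) (Q :\ C :|: Q2).
    apply/barrierP; split.
    - rewrite !subUset sXW sub1set vW /=; exact: subset_trans sYCC sCW.
    - apply/trivIsetP=> D1 D2 /setUP[D1Q|D1Q] /setUP[D2Q|D2Q] D12.
      + by apply: (trivIsetP tQ) => //; [case/setD1P: D1Q | case/setD1P: D2Q].
      + apply/pred0P=> z /=; apply/negP=> /andP[z1 z2].
        by have := other _ _ D1Q z1; rewrite (subsetP (sub2 _ D2Q)).
      + apply/pred0P=> z /=; apply/negP=> /andP[z1 z2].
        by have := other _ _ D2Q z2; rewrite (subsetP (sub2 _ D1Q)).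
      + exact: (trivIsetP t2).
    - move=> D /setUP[D1|D2].
        have [oD sD /closed_inP clD] := QP D (subsetP (subsetDl _ _) _ D1).
        split=> //.
          apply/subsetP=> z zD; have /setDP[zW zX] := subsetP sD z zD.
          rewrite in_setD zW in_setU negb_or zX andbT /=.
          have zC := other D z D1 zD; rewrite in_setU1 negb_or.
          rewrite (contraNneq _ zC) => [/=|-> //].
          by apply: contra zC; apply: (subsetP sYCC).
        apply/closed_inP=> x y xD; rewrite in_setD in_setU negb_or.
        by case/andP=> /andP[yX _] yW; apply: clD xD _; rewrite inE yX.
      have [oD sD /closed_inP clD] := Q2P D D2; split=> //.
        apply/subsetP=> z zD; have /setDP[/setD1P[zv zC] zY] := subsetP sD z zD.
        rewrite in_setD !in_setU in_set1 !negb_or (negPf zv) zY (subsetP sCW _ zC).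
        by rewrite (disjointFl dXC zC).
      apply/closed_inP=> x y xD; rewrite in_setD !in_setU in_set1 !negb_or.
      case/andP=> /and3P[yX yv yY] yW exy; apply: (clD _ _ xD _ exy).
      rewrite !inE yv yY /=; apply: (closed_inP _ _ clC _ _ _ _ exy).
        exact: (subsetP (sub2 D D2)).
      by rewrite inE yX.
  have := maxX _ _ bb; rewrite !cardsU (disjoint_setI0 d12) cards0 cards1.
  have -> : X :&: (v |: Y) = set0.
    apply/disjoint_setI0; apply: disjointWr dXC.
    by rewrite subUset sub1set vC.
  have -> : [set v] :&: Y = set0.
    apply/setP=> z; rewrite !inE; apply/negP=> /andP[/eqP-> /(subsetP sYC)].
    by rewrite !inE eqxx.
  have cQ := cardsD1 C Q; rewrite CQ in cQ; rewrite cards0 !subn0.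
  have leQ : #|X| + (1 + #|Y|) <= #|Q :\ C| + #|Q2|.
    by rewrite -eqXQ cQ add1n addSnnS leq_add2l.
  by move/(_ leQ); rewrite addnA addn1 addSn leqNgt leq_addr.
(* Hall's condition holds because a subfamily [Q'] together with its set [N] of neighbours in [X] is
   again a barrier. *)
have [|h [injh hP]] := @hall _ _ (fun C x => [exists y in C, e y x]) w0 Q X.
  move=> Q' sQ'; set N := neighbours _ _ _; apply: tutteW.
  have sNX : N \subset X by apply/subsetP=> x; rewrite inE => /andP[].
  apply/barrierP; split; [exact: subset_trans sNX sXW | exact: trivIsetS tQ |].
  move=> C CQ'; have [oC sC /closed_inP clC] := QP C (subsetP sQ' C CQ').
  split=> //; first by apply: subset_trans sC _; apply: setDS.
  apply/closed_inP=> x y xC /setDP[yW]; rewrite inE negb_and => /orP yN exy.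
  apply: (clC _ _ xC _ exy); rewrite inE yW andbT; apply/negP=> yX.
  case: yN => /negP[] //; apply/existsP; exists C; rewrite CQ' /=.
  by apply/existsP; exists x; rewrite xC.
have hQ : h @: Q = X.
  apply/eqP; rewrite eqEcard card_in_imset // eqXQ leqnn andbT.
  by apply/subsetP=> _ /imsetP[C /hP/andP[_ ?] ->].
have -> : W = \bigcup_(C in Q) (h C |: C).
  apply/setP=> z; apply/idP/bigcupP=> [zW | [C CQ /setU1P[->|zC]]].
  - case: (boolP (z \in X)) => [|zX].
      by rewrite -hQ => /imsetP[C CQ ->]; exists C; rewrite ?setU11.
    have : z \in cover Q by rewrite coverQ inE zX.
    by case/bigcupP=> C CQ zC; exists C => //; rewrite inE zC orbT.
  - by apply: (subsetP sXW); rewrite -hQ; apply: imset_f.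
  - by have [_ sC _] := QP C CQ; have /setDP[] := subsetP sC z zC.
have hX C : C \in Q -> h C \in X by case/hP/andP.
have notX C z : C \in Q -> z \in C -> z \notin X.
  by case/QP=> _ sC _ /(subsetP sC)/setDP[].
apply: perfect_matching_bigcup => [C D CQ DQ CD|C CQ].
  apply/pred0P=> z /=; apply/negP=> /andP[/setU1P[zh|zC] /setU1P[zh'|zD]].
  - by case/eqP: CD; apply: injh; rewrite -?zh.
  - by have := notX _ _ DQ zD; rewrite zh hX.
  - by have := notX _ _ CQ zC; rewrite zh' hX.
  - by have /pred0P/(_ z) := trivIsetP tQ C D CQ DQ CD; rewrite /= zC zD.
have /andP[/existsP[y /andP[yC eyh]] hCX] := hP C CQ.
have [m mP] := critical C y CQ yC.
apply: (perfect_matching_setU2 yC _ eyh mP).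
by apply/negP=> /(notX _ _ CQ); rewrite hCX.
Qed.

End Tutte.

(** * Even factors of multigraphs *)

Section Multigraph.
Variables (V E : finType) (ends : E -> {set V}).
Implicit Types (F : {set E}) (U : {set V}) (v : V).

Definition star F v := [set e in F | v \in ends e].
Definition cut F U := [set e in F | #|ends e :&: U| == 1].

End Multigraph.

Lemma subset_of_card (T : finType) (A : {set T}) n :
  n <= #|A| -> exists2 B : {set T}, B \subset A & #|B| = n.
Proof.
move=> leA; exists [set x in take n (enum A)].
  by apply/subsetP=> x; rewrite inE => /mem_take; rewrite mem_enum.
rewrite cardsE (card_uniqP _) ?take_uniq ?enum_uniq // size_takel //.
by rewrite -cardE.
Qed.

Lemma trivIset_mem_card (T : finType) (Q : {set {set T}}) x :
  trivIset Q -> #|[set C in Q | x \in C]| <= 1.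
Proof.
move=> tQ; apply/card_le1P=> C /setIdP[CQ xC] D; rewrite !inE.
apply/idP/eqP=> [/andP[DQ xD]|->]; last by rewrite CQ.
by rewrite -(def_pblock tQ DQ xD) (def_pblock tQ CQ xC).
Qed.

Lemma sum_card_trivIset (T : finType) (Q : {set {set T}}) (A : {set T}) :
  trivIset Q -> \sum_(C in Q) #|C :&: A| <= #|A|.
Proof.
move=> tQ.
have -> : \sum_(C in Q) #|C :&: A| = \sum_(x in A) #|[set C in Q | x \in C]|.
  under eq_bigr do rewrite -sum1_card.
  under [RHS]eq_bigr do rewrite -sum1_card.
  rewrite (exchange_big_dep (mem A)) => [|C x _ /setIP[]//] /=.
  apply: eq_bigr => x xA; apply: eq_bigl => C.
  by rewrite !inE xA andbT.
rewrite -sum1_card; apply: leq_sum => x _; exact: trivIset_mem_card.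
Qed.

Lemma card_gt2_notin_setU (T : finType) (A B C : {set T}) :
  #|B| <= 1 -> #|C| <= 1 -> 2 < #|A| -> ~ A \subset B :|: C.
Proof. by move=> leB leC gtA /subset_leq_card; rewrite cardsU; lia. Qed.

Lemma card2_other (T : finType) (A : {set T}) u v w : #|A| = 2 ->
  u \in A -> v \in A -> w \in A -> v != u -> w != u -> v = w.
Proof.
move=> A2 uA vA wA vu wu.
have := cardsD1 u A; rewrite A2 uA => -[/esym/eqP/cards1P[x Ax]].
have : v \in A :\ u by rewrite !inE vu.
have : w \in A :\ u by rewrite !inE wu.
by rewrite Ax !inE => /eqP-> /eqP.
Qed.

Lemma card2_ex_other (T : finType) (A : {set T}) u : #|A| = 2 -> u \in A ->
  exists2 v, v \in A & v != u.
Proof.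
move=> A2 uA; have : 0 < #|A :\ u| by have := cardsD1 u A; rewrite A2 uA; lia.
by case/card_gt0P=> v /setD1P[vu vA]; exists v.
Qed.

(** * The gadget graph of a factor problem *)

Section Gadget.
Variables (V E : finType) (ends : E -> {set V}) (D : {set E}) (W : {set V}).
Variables (f : V -> nat) (K : V -> {set E}).
Hypothesis ends2 : {in D, forall e, #|ends e| = 2}.
Hypothesis endsW : {in D, forall e, ends e \subset W}.

Notation deg v := #|star ends D v|.
Hypothesis f_lt : {in W, forall v, f v < deg v}.
Hypothesis cardK : {in W, forall v, #|K v| = deg v - f v}.

(* [inl (v, e)] is the port of [v] at the edge [e]; the [inr (v, k)], for [k]
   in [K v], are the [deg v - f v] cores of [v]. A perfect matching joins the
   cores of [v] to ports of [v], which leaves [f v] ports, to be matched along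
   their own edges. *)
Definition node : finType := (V * E + V * E)%type.

Definition adj (p q : node) :=
  match p, q with
  | inl a, inl b => (a.2 == b.2) && (a.1 != b.1)
  | inl a, inr b | inr b, inl a => a.1 == b.1
  | inr _, inr _ => false
  end.

Definition nodes : {set node} :=
  [set p : node | match p with
                  | inl a => (a.2 \in D) && (a.1 \in ends a.2)
                  | inr b => (b.1 \in W) && (b.2 \in K b.1)
                  end].

Lemma adj_sym : symmetric adj.
Proof. by case=> [a|a] [b|b] //=; rewrite eq_sym [b.1 == _]eq_sym. Qed.

Lemma port_nodes v e : (inl (v, e) \in nodes) = (e \in star ends D v).
Proof. by rewrite !inE. Qed.

Lemma core_nodes v e : (inr (v, e) \in nodes) = (v \in W) && (e \in K v).
Proof. by rewrite !inE. Qed.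

Lemma starW v e : e \in star ends D v -> v \in W.
Proof. by case/setIdP=> eD; apply: (subsetP (endsW eD)). Qed.

Lemma factor_of_matching m : perfect_matching adj nodes m ->
  exists2 F : {set E}, F \subset D & {in W, forall v, #|star ends F v| = f v}.
Proof.
move=> mP.
(* The port of [v] at [e] is matched along [e]; this does not depend on the chosen end, and the
   edges with this property form the factor. *)
pose linked v e := if m (inl (v, e)) is inl _ then true else false.
have linked_other e u v : e \in D -> u \in ends e -> v \in ends e ->
    linked u e -> linked v e.
  move=> eD ue ve; have [->//|uv] := eqVneq u v; rewrite /linked.
  have [|] := mP (inl (u, e)); first by rewrite port_nodes inE eD.
  case: (m _) => // -[w e']; rewrite !inE /= => /andP[_ we'] /andP[/eqP e1 uw].
  rewrite -e1 in we' *; have -> : w = v.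
    by apply: (card2_other (ends2 eD) ue) => //; rewrite eq_sym.
  by move=> ->.
exists [set e in D | [exists v in ends e, linked v e]].
  by apply/subsetP=> e /setIdP[].
move=> v vW.
set A := [set e in star ends D v | ~~ linked v e].
have starE : star ends [set e in D | [exists v in ends e, linked v e]] v =
             star ends D v :\: A.
  apply/setP=> e; rewrite !inE; case: (boolP (e \in D)) => //= eD.
  case: (boolP (v \in ends e)) => ve; rewrite ?andbF ?andbT //= negbK.
  apply/existsP/idP=> [[u /andP[ue]]|lve]; first exact: linked_other.
  by exists v; rewrite ve.
(* The ports of [v] not matched along their edges correspond bijectively to the cores of [v], so
   there are [deg v - f v] of them. *)
pose g e := if m (inl (v, e)) is inr b then b.2 else e.
have gP e : e \in A -> m (inl (v, e)) = inr (v, g e) /\ g e \in K v.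
  case/setIdP=> ve; rewrite /g /linked.
  have [|] := mP (inl (v, e)); first by rewrite port_nodes.
  case: (m _) => // -[w k]; rewrite inE /= => /andP[_ kK] /eqP vw _.
  by rewrite vw.
have injg : {in A &, injective g}.
  move=> e1 e2 e1A e2A eqg.
  have [|_ _ m1] := mP (inl (v, e1)); first by case/setIdP: e1A; rewrite port_nodes.
  have [|_ _ m2] := mP (inl (v, e2)); first by case/setIdP: e2A; rewrite port_nodes.
  have [g1 _] := gP _ e1A; have [g2 _] := gP _ e2A.
  by move: m1; rewrite g1 eqg -g2 m2 => -[].
have gA : g @: A = K v.
  apply/setP=> k; apply/imsetP/idP=> [[e /gP[_ gK] -> //]|kK].
  have [|] := mP (inr (v, k)); first by rewrite core_nodes vW.
  case mk: (m _) => [[w e]|//]; rewrite port_nodes /= => ve /eqP wv.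
  move=> me; rewrite wv in mk ve me; exists e; last by rewrite /g me.
  by rewrite inE ve /linked me.
rewrite starE cardsD (setIidPr _); last by apply/subsetP=> e /setIdP[].
have := card_in_imset injg; rewrite gA cardK // => <-.
by have := f_lt vW; lia.
Qed.

Lemma card_node (A : {set node}) :
  #|A| = \sum_v (#|[set e | inl (v, e) \in A]| + #|[set e | inr (v, e) \in A]|).
Proof.
rewrite -sum1_card big_sumType /= big_split /=; congr (_ + _).
  under [RHS]eq_bigr do rewrite -sum1dep_card.
  by rewrite pair_big_dep; apply: eq_bigl => -[].
under [RHS]eq_bigr do rewrite -sum1dep_card.
by rewrite pair_big_dep; apply: eq_bigl => -[].
Qed.

Hypothesis f_even : {in W, forall v, ~~ odd (f v)}.

(** A vertex of [W] has [deg v] ports and [deg v - f v] cores, an even number in total since [f v]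
    is even. *)
Lemma nodes_even : ~~ odd #|nodes|.
Proof.
rewrite card_node; apply: (big_ind (fun n => ~~ odd n)) => //.
  by move=> a b /negPf ea /negPf eb; rewrite oddD ea eb.
move=> v _; have -> : [set e | inl (v, e) \in nodes] = star ends D v.
  by apply/setP=> e; rewrite inE port_nodes.
case: (boolP (v \in W)) => vW; last first.
  rewrite [X in X + _](_ : _ = 0); last first.
    by apply: eq_card0 => e; apply/negP=> /starW; rewrite (negPf vW).
  by rewrite eq_card0 // => e; rewrite inE core_nodes (negPf vW).
have -> : [set e | inr (v, e) \in nodes] = K v.
  by apply/setP=> e; rewrite inE core_nodes vW.
by rewrite cardK //; have := f_lt vW; have := f_even vW; lia.
Qed.

(** * Minimal barriers of the gadget graph and their charges *)

Section Barrier.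
Variables (X : {set node}) (Q : {set {set node}}).
Hypothesis barQ : barrier adj nodes X Q.
Hypothesis bigQ : #|X|.+1 < #|Q|.
Hypothesis minX :
  {in X, forall x, 2 < #|[set C in Q | [exists y in C, adj x y]]|}.

(* The sets usually written S and T in Tutte's f-factor theorem. Minimality of
   the barrier makes X the union of all ports of S and all cores of T. *)
Definition portsX : {set V} := [set v | [exists e, inl (v, e) \in X]].
Definition coresX : {set V} := [set v | [exists e, inr (v, e) \in X]].

Lemma barQ_trivIset : trivIset Q.
Proof. by case/barrierP: barQ. Qed.

Lemma barQ_sub x : x \in X -> x \in nodes.
Proof. by case/barrierP: barQ => /subsetP sX _ _; apply: sX. Qed.

Lemma barQ_mem C x : C \in Q -> x \in C -> x \in nodes /\ x \notin X.
Proof.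
by case/barrierP: barQ => _ _ QP /QP[_ /subsetP sC _] /sC /setDP[].
Qed.

Lemma barQ_closed C x y : C \in Q -> x \in C -> y \in nodes -> y \notin X ->
  adj x y -> y \in C.
Proof.
case/barrierP: barQ => _ _ QP /QP[_ _ /closed_inP clC] xC yN yX.
by apply: clC xC _; rewrite inE yX.
Qed.

Lemma portsXW v : v \in portsX -> v \in W.
Proof. by rewrite inE => /existsP[e /barQ_sub]; rewrite port_nodes => /starW. Qed.

Lemma coresXW v : v \in coresX -> v \in W.
Proof.
by rewrite inE => /existsP[e /barQ_sub]; rewrite core_nodes => /andP[].
Qed.

(** A port outside [X] is adjacent to all cores of [v], so only its own member can contain any of
    them. A port of [v] in [X] would then see at most this member and the one containing the other
    port of its edge, against minimality. *)
Lemma portsX_all v e : v \in portsX -> e \in star ends D v -> inl (v, e) \in X.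
Proof.
rewrite inE => /existsP[e0 e0X] ve; apply/negPn/negP=> eX.
have := barQ_sub e0X; rewrite port_nodes => /setIdP[e0D ve0].
have [u ue0 uv] := card2_ex_other (ends2 e0D) ve0.
suff sub : [set C in Q | [exists y in C, adj (inl (v, e0)) y]] \subset
    [set C in Q | inl (v, e) \in C] :|: [set C in Q | inl (u, e0) \in C].
  by case: (card_gt2_notin_setU _ _ (minX e0X) sub);
    apply: trivIset_mem_card barQ_trivIset.
apply/subsetP=> C /setIdP[CQ /existsP[[[w e1]|[w k]] /andP[yC]]] /=; last first.
  move=> /eqP vw; rewrite in_setU inE CQ /=; apply/orP; left.
  by apply: (barQ_closed CQ yC) => //=; rewrite ?port_nodes // vw.
case/andP=> /eqP e01 vw; subst e1; rewrite in_setU !inE CQ /=; apply/orP; right.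
have [] := barQ_mem CQ yC; rewrite port_nodes => /setIdP[_ we0] _.
by rewrite (card2_other (ends2 e0D) ve0 ue0 we0) // eq_sym.
Qed.

(** All cores of [v] have the same neighbours. If one lies outside [X], another one in [X] sees at
    most the member of [Q] containing the first. *)
Lemma coresX_all v k : v \in coresX -> k \in K v -> inr (v, k) \in X.
Proof.
rewrite inE => /existsP[k0 k0X] kK; apply/negPn/negP=> kX.
have vW : v \in W by have := barQ_sub k0X; rewrite core_nodes => /andP[].
suff sub : [set C in Q | [exists y in C, adj (inr (v, k0)) y]] \subset
    [set C in Q | inr (v, k) \in C].
  have := leq_trans (minX k0X) (subset_leq_card sub).
  by rewrite ltnNge ltnW // ltnS; apply: trivIset_mem_card barQ_trivIset.
apply/subsetP=> C /setIdP[CQ /existsP[[[w e1]|[w k1]] /andP[yC //= wv]]].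
rewrite inE CQ; apply: (barQ_closed CQ yC) => //.
by rewrite core_nodes vW.
Qed.

(** A core is adjacent only to ports of its vertex; if these all lie in [X], it sees no member of
    [Q]. *)
Lemma portsX_coresX v : v \in portsX -> v \notin coresX.
Proof.
move=> vS; apply/negP; rewrite inE => /existsP[k kX].
have /card_gt0P[C] := ltn_trans (isT : 0 < 2) (minX kX).
case/setIdP=> CQ /existsP[[[w e]|[w k1]] /andP[yC //= /eqP wv]]; subst w.
have [yN /negP[]] := barQ_mem CQ yC; apply: portsX_all => //.
by rewrite -port_nodes.
Qed.

(** Ports and cores of [v] form a complete bipartite graph, which is connected as [f v < deg v]
    leaves at least one core and one port. None of it is in [X], so one member takes all of it. *)
Lemma unsaturated_tied C v : C \in Q -> v \notin portsX -> v \notin coresX ->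
    [exists e, (inl (v, e) \in C) || (inr (v, e) \in C)] ->
  {in star ends D v, forall e, inl (v, e) \in C} /\
  {in K v, forall k, inr (v, k) \in C}.
Proof.
move=> CQ vS vT exC.
have portX e : inl (v, e) \notin X.
  by apply: contra vS => eX; rewrite inE; apply/existsP; exists e.
have coreX k : inr (v, k) \notin X.
  by apply: contra vT => kX; rewrite inE; apply/existsP; exists k.
have vW : v \in W.
  case/existsP: exC => e /orP[] /(barQ_mem CQ)[]; rewrite ?port_nodes ?core_nodes.
    by move/starW.
  by case/andP.
have c2p k : inr (v, k) \in C -> {in star ends D v, forall e, inl (v, e) \in C}.
  move=> kC e ve; apply: (barQ_closed CQ kC) => //; first by rewrite port_nodes.
  by rewrite /= eqxx.
have p2c e : inl (v, e) \in C -> {in K v, forall k, inr (v, k) \in C}.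
  move=> eC k kK; apply: (barQ_closed CQ eC) => //; first by rewrite core_nodes vW.
  by rewrite /= eqxx.
have ltf := f_lt vW.
have [e ve] : exists e, e \in star ends D v by apply/card_gt0P; lia.
have [k kK] : exists k, k \in K v by apply/card_gt0P; rewrite cardK //; lia.
case/existsP: exC => e' /orP[e'C|e'C].
  by have cC := p2c _ e'C; split=> //; apply: c2p (cC k kK).
by have pC := c2p _ e'C; split=> //; apply: p2c (pC e ve).
Qed.

Lemma cardX : #|X| = \sum_v ((v \in portsX) * deg v + (v \in coresX) * (deg v - f v)).
Proof.
rewrite card_node; apply: eq_bigr => v _; congr (_ + _).
  case: (boolP (v \in portsX)) => vS; rewrite ?mul1n ?mul0n.
    apply: eq_card => e; rewrite inE; apply/idP/idP=> [/barQ_sub|].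
      by rewrite port_nodes.
    exact: portsX_all.
  apply: eq_card0 => e; rewrite inE; apply: contraNF vS => eX.
  by rewrite inE; apply/existsP; exists e.
case: (boolP (v \in coresX)) => vT; rewrite ?mul1n ?mul0n.
  rewrite -cardK ?(coresXW vT) //.
  apply: eq_card => e; rewrite inE; apply/idP/idP=> [/barQ_sub|].
    by rewrite core_nodes => /andP[].
  exact: coresX_all.
apply: eq_card0 => e; rewrite inE; apply: contraNF vT => eX.
by rewrite inE; apply/existsP; exists e.
Qed.

Variables (r kap : nat) (om : V).
Hypothesis kap_le : 3 * kap <= 2 * r.
Hypothesis f_ratio : {in W, forall v, v != om -> r * f v = kap * deg v}.
Hypothesis f_om_lt : r * f om < kap * deg om + 2 * r.
Hypothesis f_om_gt : kap * deg om < r * f om + 2 * r.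
Hypothesis cut_ge2 : forall U : {set V},
  U \subset W -> U != set0 -> U != W -> 1 < #|cut ends D U|.

(** The three traces that [X] leaves on the members of [Q]: cores isolated because all ports of
    their vertex are in [X], ports whose cores are in [X], and ports whose partner along the edge is
    in [X]. *)
Definition saturated_cores : {set node} :=
  [set p : node | if p is inr b then b.1 \in portsX else false].
Definition free_ports : {set node} :=
  [set p : node | if p is inl a then a.1 \in coresX else false].
Definition linked_ports : {set node} :=
  [set p : node | if p is inl a
                  then [exists u in ends a.2, (u != a.1) && (u \in portsX)]
                  else false].

Lemma port_free A v e :
  (inl (v, e) \in A :&: free_ports) = (inl (v, e) \in A) && (v \in coresX).
Proof. by rewrite in_setI [_ \in free_ports]inE. Qed.

Lemma core_free A b : (inr b \in A :&: free_ports) = false.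
Proof. by rewrite in_setI [_ \in free_ports]inE andbF. Qed.

Lemma core_saturated A v k :
  (inr (v, k) \in A :&: saturated_cores) = (inr (v, k) \in A) && (v \in portsX).
Proof. by rewrite in_setI [_ \in saturated_cores]inE. Qed.

Lemma port_saturated A b : (inl b \in A :&: saturated_cores) = false.
Proof. by rewrite in_setI [_ \in saturated_cores]inE andbF. Qed.

Lemma port_linked A v e : (inl (v, e) \in A :&: linked_ports) =
  (inl (v, e) \in A) && [exists u in ends e, (u != v) && (u \in portsX)].
Proof. by rewrite in_setI [_ \in linked_ports]inE. Qed.

Lemma core_linked A b : (inr b \in A :&: linked_ports) = false.
Proof. by rewrite in_setI [_ \in linked_ports]inE andbF. Qed.

Lemma port_mem C v u e : C \in Q -> inl (v, e) \in C -> u \in ends e -> u != v ->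
  u \notin portsX -> inl (u, e) \in C.
Proof.
move=> CQ eC ue uv uS; have [] := barQ_mem CQ eC; rewrite port_nodes.
case/setIdP=> eD ve _; apply: (barQ_closed CQ eC); last first.
- by rewrite /= eqxx eq_sym uv.
- by apply: contra uS => eX; rewrite inE; apply/existsP; exists e.
- by rewrite port_nodes inE eD.
Qed.

(** Count [C] modulo 2 vertex by vertex: a vertex of [portsX] contributes nothing, one of [coresX]
    only free ports, and any other vertex either nothing or the even number [2 * deg v - f v]. *)
Lemma odd_free_ports C : C \in Q -> C :&: saturated_cores = set0 ->
  C :&: free_ports :&: linked_ports = set0 -> odd #|C :&: free_ports|.
Proof.
move=> CQ C1 C2.
have oC : odd #|C| by case/barrierP: barQ => _ _ QP; case: (QP C CQ).
suff -> : odd #|C :&: free_ports| = odd #|C| by [].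
rewrite !card_node.
apply: (big_ind2 (fun a b => odd a = odd b)) => // [a b c d eab ecd|v _].
  by rewrite !oddD eab ecd.
have noport e : v \in portsX -> inl (v, e) \notin C.
  move=> vS; apply/negP=> eC; have [] := barQ_mem CQ eC.
  by rewrite port_nodes => ve; rewrite portsX_all.
have nocore e : v \in coresX -> inr (v, e) \notin C.
  move=> vT; apply/negP=> eC; have [] := barQ_mem CQ eC.
  by rewrite core_nodes => /andP[_ ve]; rewrite coresX_all.
rewrite [X in odd (_ + X) = _]eq_card0 ?addn0; last first.
  by move=> e; rewrite inE core_free.
case: (boolP (v \in coresX)) => vT.
  rewrite [X in _ = odd (_ + X)]eq_card0 ?addn0; last first.
    by move=> e; rewrite inE (negPf (nocore e vT)).
  by congr odd; apply: eq_card => e; rewrite [LHS]inE [RHS]inE port_free vT andbT.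
rewrite [X in odd X]eq_card0; last first.
  by move=> e; rewrite inE port_free (negPf vT) andbF.
case: (boolP (v \in portsX)) => vS.
  rewrite eq_card0 ?add0n; last by move=> e; rewrite inE (negPf (noport e vS)).
  rewrite eq_card0 // => e; rewrite inE; apply/negP=> eC.
  have : inr (v, e) \in C :&: saturated_cores by rewrite core_saturated eC.
  by rewrite C1 inE.
case: (boolP [exists e, (inl (v, e) \in C) || (inr (v, e) \in C)]) => [exC|].
  have [pC cC] := unsaturated_tied CQ vS vT exC.
  have vW : v \in W.
    case/existsP: exC => e /orP[] /(barQ_mem CQ)[]; rewrite ?port_nodes ?core_nodes.
      by move/starW.
    by case/andP.
  have -> : [set e | inl (v, e) \in C] = star ends D v.
    apply/setP=> e; rewrite inE; apply/idP/idP; last exact: pC.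
    by case/(barQ_mem CQ); rewrite port_nodes.
  have -> : [set e | inr (v, e) \in C] = K v.
    apply/setP=> e; rewrite inE; apply/idP/idP; last exact: cC.
    by case/(barQ_mem CQ); rewrite core_nodes => /andP[].
  by rewrite cardK //; have := f_lt vW; have := f_even vW; lia.
rewrite negb_exists => /forallP exC; rewrite !eq_card0 // => e; rewrite inE.
  by apply/negP=> eC; have := exC e; rewrite eC orbT.
by apply/negP=> eC; have := exC e; rewrite eC.
Qed.

(* Give each edge the weight kap / r, and each port the weight 1 - kap / r
   towards its cores: an odd member of Q is left by a total weight at least 1.
   As f is even, the parity is that of the free ports; a lone free port costs
   1 - kap / r, and since all cuts have two edges, some edge to a saturated
   vertex provides the missing kap / r. *)
Lemma member_charge C : C \in Q ->
  r <= r * #|C :&: saturated_cores| + (r - kap) * #|C :&: free_ports|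
       + kap * #|C :&: linked_ports|.
Proof.
move=> CQ.
have [C1|[p pC]] := set_0Vmem (C :&: saturated_cores); last first.
  have : 0 < #|C :&: saturated_cores| by apply/card_gt0P; exists p.
  by move=> gt0; rewrite -addnA; apply: leq_trans (leq_addr _ _); rewrite leq_pmulr.
rewrite C1 cards0 muln0 add0n.
have charge2 : 0 < #|C :&: free_ports| -> 0 < #|C :&: linked_ports| ->
    r <= (r - kap) * #|C :&: free_ports| + kap * #|C :&: linked_ports|.
  move=> gt1 gt2; rewrite -[X in X <= _](@subnK kap); last by lia.
  by apply: leq_add; rewrite leq_pmulr.
have [C2|[p]] := set_0Vmem (C :&: free_ports :&: linked_ports); last first.
  case/setIP=> /setIP[pC p1] p2.
  by apply: charge2; apply/card_gt0P; exists p; apply/setIP.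
have oddt := odd_free_ports CQ C1 C2.
(* Three free ports suffice: [3 * (r - kap)] is at least [r] exactly because [3 * kap <= 2 * r]. *)
have [t3|] := leqP 3 #|C :&: free_ports|.
  apply: leq_trans (leq_addr _ _); apply: leq_trans (leq_mul (leqnn _) t3); lia.
move=> lt3; have /eqP/cards1P[p Cp] : #|C :&: free_ports| = 1.
  by case: #|_| oddt lt3 => [|[|[|]]].
apply: charge2; first by rewrite Cp cards1.
have: p \in C :&: free_ports by rewrite Cp set11.
case: p Cp => [[v e]|b] Cp; last by rewrite core_free.
move=> pCT; have := pCT; rewrite port_free => /andP[pC vT].
have [] := barQ_mem CQ pC; rewrite port_nodes => /setIdP[eD ve] _.
have [u ue uv] := card2_ex_other (ends2 eD) ve.
have uS : u \notin portsX.
  apply/negP=> uS; move/setP/(_ (inl (v, e))): C2.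
  by rewrite port_linked pCT inE => /existsP[]; exists u; rewrite ue uv.
have uC := port_mem CQ pC ue uv uS.
have uT : u \notin coresX.
  apply: contra uv => uT.
  have : inl (u, e) \in C :&: free_ports by rewrite port_free uC.
  by rewrite Cp inE => /eqP[->].
(* [U] holds the vertices tied to [C]. Its cut has an edge [e'] other than [e], whose outer end is
   in neither [U] nor, as [C] has no second free port, in [coresX]. That end is therefore in
   [portsX], which makes the inner port linked. *)
pose U := [set w | [&& w \notin portsX, w \notin coresX &
  [exists e, (inl (w, e) \in C) || (inr (w, e) \in C)]]].
have UW : U \subset W.
  apply/subsetP=> w; rewrite inE => /and3P[_ _ /existsP[e' /orP[]]] /(barQ_mem CQ)[].
    by rewrite port_nodes => /starW.
  by rewrite core_nodes => /andP[].
have /cut_ge2 : U \subset W := UW.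
have -> : U != set0.
  apply/set0Pn; exists u; rewrite inE uS uT; apply/existsP; exists e.
  by rewrite uC.
have -> : U != W.
  apply: contraTneq (coresXW vT) => <-; by rewrite inE vT andbF.
move/(_ isT isT); rewrite (cardsD1 e) => cut2.
have /card_gt0P[e'] : 0 < #|cut ends D U :\ e| by move: cut2; clear; case: (_ \in _); lia.
rewrite !inE => /and3P[e'e e'D /cards1P[w Uw]].
have /setIP[we' wU] : w \in ends e' :&: U by rewrite Uw set11.
have [w' w'e' w'w] := card2_ex_other (ends2 e'D) we'.
have wC : inl (w, e') \in C.
  move: wU; rewrite inE => /and3P[wS wT exC].
  have [pC' _] := unsaturated_tied CQ wS wT exC.
  by apply: pC'; rewrite inE e'D.
case: (boolP (w' \in portsX)) => w'S.
  apply/card_gt0P; exists (inl (w, e')); rewrite port_linked wC.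
  by apply/existsP; exists w'; rewrite w'e' w'w.
have w'C := port_mem CQ wC w'e' w'w w'S.
have w'U : w' \notin U.
  apply: contra w'w => w'U.
  have : w' \in ends e' :&: U by apply/setIP.
  by rewrite Uw inE.
case: (boolP (w' \in coresX)) => w'T.
  have : inl (w', e') \in C :&: free_ports by rewrite port_free w'C.
  by rewrite Cp inE => /eqP[_ e'e1]; rewrite e'e1 eqxx in e'e.
case/negP: w'U; rewrite inE w'S w'T; apply/existsP; exists e'; by rewrite w'C.
Qed.

Lemma card_saturated_cores : #|nodes :&: saturated_cores| =
  \sum_v (v \in portsX) * (deg v - f v).
Proof.
rewrite card_node; apply: eq_bigr => v _.
rewrite eq_card0 ?add0n; last by move=> e; rewrite inE port_saturated.
case: (boolP (v \in portsX)) => vS; last first.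
  by apply: eq_card0 => e; rewrite inE core_saturated (negPf vS) andbF.
rewrite mul1n -cardK ?portsXW //; apply: eq_card => e.
by rewrite inE core_saturated core_nodes vS portsXW ?andbT.
Qed.

Lemma card_free_ports : #|nodes :&: free_ports| =
  \sum_v (v \in coresX) * deg v.
Proof.
rewrite card_node; apply: eq_bigr => v _.
rewrite [X in _ + X]eq_card0 ?addn0; last by move=> e; rewrite inE core_free.
case: (boolP (v \in coresX)) => vT; last first.
  by apply: eq_card0 => e; rewrite inE port_free (negPf vT) andbF.
rewrite mul1n; apply: eq_card => e.
by rewrite inE port_free port_nodes vT andbT.
Qed.

(** Sending a linked port to the opposite port of its edge is injective and lands among the ports of
    [portsX]. *)
Lemma card_linked_ports : #|nodes :&: linked_ports| <=
  \sum_v (v \in portsX) * deg v.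
Proof.
pose SP := [set p in nodes | if p is inl a then a.1 \in portsX else false].
have <- : #|SP| = \sum_v (v \in portsX) * deg v.
  rewrite card_node; apply: eq_bigr => v _.
  rewrite [X in _ + X]eq_card0 ?addn0; last by move=> e; rewrite !inE andbF.
  case: (boolP (v \in portsX)) => vS; last first.
    by apply: eq_card0 => e; rewrite inE in_set /= (negPf vS) andbF.
  by rewrite mul1n; apply: eq_card => e; rewrite inE in_set port_nodes /= vS andbT.
pose mate (p : node) : node := if p is inl a then
  inl (odflt a.1 [pick u in ends a.2 | u != a.1], a.2) else p.
have mateP v e : inl (v, e) \in nodes :&: linked_ports ->
    exists u, [/\ mate (inl (v, e)) = inl (u, e), u != v, u \in ends e,
                  u \in portsX & v \in ends e /\ e \in D].
  rewrite port_linked port_nodes => /andP[/setIdP[eD ve]].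
  case/existsP=> u /and3P[ue uv uS]; exists u; split=> //.
  rewrite /mate; case: pickP => [u' /andP[u'e u'v]|/(_ u)]; last by rewrite ue uv.
  by rewrite (card2_other (ends2 eD) ve u'e ue).
rewrite -(card_in_imset (f := mate)).
  apply/subset_leq_card/subsetP=> _ /imsetP[[[v e]|b] pL ->]; last first.
    by move: pL; rewrite core_linked.
  have [u [-> _ ue uS [_ eD]]] := mateP _ _ pL.
  by rewrite in_set port_nodes inE eD ue.
move=> [[v e]|b] [[v' e']|b'] pL pL'; try by move: pL pL'; rewrite ?core_linked.
have [u [-> uv ue _ [ve eD]]] := mateP _ _ pL.
have [u' [-> uv' ue' _ [ve' _]]] := mateP _ _ pL'.
move=> [eu ee]; subst u' e'.
by rewrite (card2_other (ends2 eD) ue ve ve') // eq_sym.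
Qed.

(* Summing the charges gives r #|Q| < r #|X| + 2 r: vertices other than om
   balance exactly. *)
Lemma minimal_barrier_false : False.
Proof.
have sum_cap (A : {set node}) :
    \sum_(C in Q) #|C :&: A| <= #|nodes :&: A|.
  rewrite (leq_trans _ (sum_card_trivIset (nodes :&: A) barQ_trivIset)) //.
  apply: leq_sum => C CQ; apply/subset_leq_card/subsetP=> x /setIP[xC xA].
  by rewrite !in_setI xC xA; have [-> _] := barQ_mem CQ xC.
have charge : r * #|Q| <= \sum_v
    (r * ((v \in portsX) * (deg v - f v)) + (r - kap) * ((v \in coresX) * deg v)
     + kap * ((v \in portsX) * deg v)).
  rewrite !big_split -!big_distrr /= mulnC -sum_nat_const.
  apply: leq_trans (leq_sum _ member_charge) _.
  rewrite !big_split -!big_distrr /= -card_saturated_cores -card_free_ports.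
  rewrite !leq_add // leq_mul2l ?sum_cap ?orbT //.
  by rewrite (leq_trans (sum_cap _) card_linked_ports) orbT.
have : r * #|Q| < r * #|X| + 2 * r.
  apply: leq_ltn_trans charge _; rewrite cardX big_distrr /=.
  have kr : kap <= r by lia.
  (* From [r * f v = kap * deg v], a vertex of [portsX] has [r * (deg v - f v) + kap * deg v = r *
     deg v], and one of [coresX] has [(r - kap) * deg v = r * (deg v - f v)]. *)
  rewrite (bigD1 om) //= (eq_bigr (fun v =>
    r * ((v \in portsX) * deg v + (v \in coresX) * (deg v - f v)))); last first.
    move=> v vom; case: (boolP (v \in portsX)) => vS.
      rewrite (negPf (portsX_coresX vS)) !mul0n !mul1n muln0 !addn0.
      move: (f_lt (portsXW vS)) (f_ratio (portsXW vS) vom) kr; clear; nia.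
    case: (boolP (v \in coresX)) => vT; rewrite !mul0n !muln0 ?mul1n !add0n ?addn0 //.
    move: (f_lt (coresXW vT)) (f_ratio (coresXW vT) vom) kr; clear; nia.
  rewrite [X in _ < X + _](bigD1 om) //= [X in _ < X]addnAC ltn_add2r.
  case: (boolP (om \in portsX)) => omS.
    rewrite (negPf (portsX_coresX omS)) !mul0n !mul1n muln0 !addn0.
    by move: (f_lt (portsXW omS)) f_om_gt kr; clear; nia.
  case: (boolP (om \in coresX)) => omT; rewrite !mul0n !muln0 ?mul1n !add0n ?addn0.
    by move: (f_lt (coresXW omT)) f_om_lt kr; clear; nia.
  by move: f_om_gt; clear; lia.
have r_gt0 : 0 < r by lia.
by rewrite [2 * r]mulnC -mulnDr ltn_pmul2l // addn2 ltnS leqNgt bigQ.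
Qed.

End Barrier.
End Gadget.

(** Without a factor the gadget graph has a minimal barrier, whose charges are contradictory. Parity
    gives the barrier a surplus of 2, which is why [om] may miss its proportional degree by anything
    less than 2. *)
Theorem factor_of_cuts (V E : finType) (ends : E -> {set V}) (D : {set E})
    (W : {set V}) (f : V -> nat) (r kap : nat) (om : V) :
    {in D, forall e, #|ends e| = 2} ->
    {in D, forall e, ends e \subset W} ->
    {in W, forall v, ~~ odd (f v) && (f v < #|star ends D v|)} ->
    {in W, forall v, v != om -> r * f v = kap * #|star ends D v|} ->
    3 * kap <= 2 * r ->
    r * f om < kap * #|star ends D om| + 2 * r ->
    kap * #|star ends D om| < r * f om + 2 * r ->
    (forall U : {set V}, U \subset W -> U != set0 -> U != W ->
       1 < #|cut ends D U|) ->
  exists2 F : {set E}, F \subset D & {in W, forall v, #|star ends F v| = f v}.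
Proof.
move=> ends2 endsW fP f_ratio kap_le f_om_lt f_om_gt cut_ge2.
have f_lt : {in W, forall v, f v < #|star ends D v|} by move=> v /fP/andP[].
have f_even : {in W, forall v, ~~ odd (f v)} by move=> v /fP/andP[].
(* Edges serve only as labels for the cores, so any set of the right size will do. *)
have /fin_all_exists[K KP] v : exists Kv : {set E},
    #|Kv| = #|star ends D v| - f v.
  by have [B _ cB] := subset_of_card (leq_subr (f v) #|star ends D v|); exists B.
have cardK : {in W, forall v, #|K v| = #|star ends D v| - f v} by move=> v _.
have [|m /factor_of_matching] := tutte (@adj_sym V E) (W := nodes ends D W K).
  move=> X Q bQ; rewrite leqNgt; apply/negP=> ltXQ.
  have := minimal_barrier (@adj_sym V E) bQ _ ltXQ.
  case=> [|X' [Q' [bQ' ltXQ' minX']]]; first exact: nodes_even cardK f_even.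
  exact: (minimal_barrier_false ends2 endsW f_lt cardK f_even bQ' ltXQ' minX'
            kap_le f_ratio f_om_lt f_om_gt cut_ge2).
exact.
Qed.

(** * Leaves *)

Lemma card_sum_mem (T : finType) (A : {set T}) : #|A| = \sum_x (x \in A).
Proof. by rewrite -sum1_card -big_mkcond. Qed.

Lemma mem_cut (V E : finType) (ends : E -> {set V}) F U e x y :
  #|ends e| = 2 -> ends e = [set x; y] ->
  (e \in cut ends F U) = (e \in F) && ((x \in U) != (y \in U)).
Proof.
move=> e2 exy; rewrite inE exy; congr (_ && _).
have xy : x != y by apply: contra_eq_neq e2 => xy; rewrite exy xy setUid cards1.
rewrite setIUl cardsU.
have -> : [set x] :&: U :&: ([set y] :&: U) = set0.
  apply/setP=> z; rewrite !inE; case: eqVneq => //= -> .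
  by rewrite (negPf xy) andbF.
have cap1 z : #|[set z] :&: U| = (z \in U).
  case: (boolP (z \in U)) => zU; first by rewrite (setIidPl _) ?cards1 // sub1set.
  by rewrite disjoint_setI0 ?cards0 // disjoints_subset sub1set inE.
by rewrite cards0 subn0 !cap1; case: (x \in U); case: (y \in U).
Qed.

Section Cuts.
Variables (V E : finType) (ends : E -> {set V}).
Hypothesis ends2 : forall e, #|ends e| = 2.
Implicit Types (F : {set E}) (U : {set V}).

Lemma endsE e : exists x y, ends e = [set x; y].
Proof. by have /eqP/cards2P[x [y [_ exy]]] := ends2 e; exists x, y. Qed.

(* Submodularity of the cut function, applied to U and ~: W. *)
Lemma cut_uncross F U W :
  #|cut ends F (U :\: W)| + #|cut ends F (W :\: U)| <=
  #|cut ends F U| + #|cut ends F W|.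
Proof.
rewrite !card_sum_mem -!big_split /=; apply: leq_sum => e _.
have [x [y exy]] := endsE e; rewrite !(mem_cut _ _ (ends2 _) exy) !inE.
by case: (e \in F) (x \in U) (y \in U) (x \in W) (y \in W) => [] [] [] [] [].
Qed.

Definition inner (B : {set V}) : {set E} := [set e | ends e \subset B].

(** An edge between [U] and [B :\: U] counts twice on both sides, and an edge leaving [B] once on
    both sides. *)
Lemma cut_inner_split (B U : {set V}) : U \subset B ->
  #|cut ends setT U| + #|cut ends setT (B :\: U)| <=
  2 * #|cut ends (inner B) U| + #|cut ends setT B|.
Proof.
move=> /subsetP UB.
rewrite !card_sum_mem mul2n -addnn -!big_split /=; apply: leq_sum => e _.
have [x [y exy]] := endsE e; rewrite !(mem_cut _ _ (ends2 _) exy) !inE exy subUset !sub1set.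
case: (boolP (x \in U)) => xU; case: (boolP (y \in U)) => yU;
  rewrite ?(UB _ xU) ?(UB _ yU) //=.
- by case: (y \in B).
- by case: (x \in B).
- by case: (y \in B); case: (x \in B).
Qed.

Lemma card_star_inner (B : {set V}) v : v \in B ->
  #|star ends setT v| = #|star ends (inner B) v| + #|star ends (cut ends setT B) v|.
Proof.
move=> vB; rewrite !card_sum_mem -big_split /=; apply: eq_bigr => e _.
have [x [y exy]] := endsE e; rewrite ![_ \in star _ _ _]in_set.
rewrite (mem_cut _ _ (ends2 _) exy) !in_setT [e \in inner B]in_set.
rewrite exy subUset !sub1set !inE /=.
have [<-|_] := eqVneq v x; have [<-|_] := eqVneq v y; rewrite ?vB //=.
- by case: (_ \in B).
- by case: (_ \in B).
- by rewrite !andbF.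
Qed.

(** The whole vertex set may be low, so that a 2-edge-connected graph is itself its only leaf. *)
Definition low U := (U != set0) && (#|cut ends setT U| <= 1).
Definition leaf U := minset low U.
Definition leaves : {set {set V}} := [set B | leaf B].

Lemma leaf_low B : leaf B -> low B.
Proof. exact: minsetp. Qed.

Lemma low_leaf U : low U -> exists2 B, leaf B & B \subset U.
Proof. by case/minset_exists=> B; exists B. Qed.

Lemma leaf_min B U : leaf B -> U \subset B -> U != B -> U != set0 ->
  1 < #|cut ends setT U|.
Proof.
move=> /minsetP[_ minB] UB UnB U0; rewrite ltnNge; apply/negP=> lowU.
by case/eqP: UnB; apply: minB; rewrite // /low U0.
Qed.

(** If two distinct leaves met, both differences would be nonempty proper subsets of leaves and have
    cuts of size at least 2, whereas uncrossing bounds the sum of these cuts by 2. *)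
Lemma leaf_disjoint B1 B2 : leaf B1 -> leaf B2 -> B1 != B2 -> [disjoint B1 & B2].
Proof.
move=> l1 l2 B12.
have [/andP[n1 c1] /andP[n2 c2]] := (leaf_low l1, leaf_low l2).
have diff0 A B : leaf A -> leaf B -> A != B -> A :\: B != set0.
  move=> lA lB AB; rewrite setD_eq0; apply/negP=> sAB.
  have /andP[nA cA] := leaf_low lA.
  by have := leaf_min lB sAB AB nA; rewrite ltnNge cA.
rewrite -setI_eq0; apply/negPn/negP=> nI.
have lt A B : leaf A -> leaf B -> A != B -> A :&: B != set0 ->
    1 < #|cut ends setT (A :\: B)|.
  move=> lA lB AB nAB; apply: (leaf_min lA); first exact: subsetDl.
    apply: contra nAB => /eqP/setDidPl; by rewrite setI_eq0.
  exact: diff0.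
have := cut_uncross setT B1 B2; have := lt _ _ l1 l2 B12 nI.
rewrite setIC in nI; rewrite eq_sym in B12; have := lt _ _ l2 l1 B12 nI.
by move: c1 c2; clear; lia.
Qed.

(** * Factors inside and outside the leaves of a regular graph *)

Variable r : nat.
Hypothesis r_ge5 : 5 <= r.
Hypothesis reg : forall v, #|star ends setT v| = r.

(** Inside a leaf all degrees are [r], except possibly [r - 1] at the end [om] of the leaving edge;
    such an error is within the tolerance of [factor_of_cuts]. *)
Lemma leaf_factor B kap : leaf B -> ~~ odd kap -> 3 * kap <= 2 * r ->
  exists2 F : {set E}, F \subset inner B &
    {in B, forall v, #|star ends F v| = kap}.
Proof.
move=> lB kap_even kap_le; have /andP[/set0Pn[v0 v0B] cB] := leaf_low lB.
have [om omB omP] : exists2 om, om \in B &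
    {in B, forall v, v != om -> #|star ends (cut ends setT B) v| = 0}.
  have [c0|[e eB]] := set_0Vmem (cut ends setT B).
    exists v0 => // v _ _; apply: eq_card0 => e.
    by rewrite c0 !inE.
  have := eB; rewrite inE => /andP[_ /cards1P[om omE]].
  have /setIP[ome omB] : om \in ends e :&: B by rewrite omE set11.
  exists om => // v vB vom; apply: eq_card0 => e'; rewrite inE.
  apply/negP=> /andP[e'B ve'].
  have e'e : e' = e by apply: (card_le1_eqP cB).
  have : v \in ends e :&: B by rewrite inE -e'e ve'.
  by rewrite omE inE (negPf vom).
have degE v : v \in B ->
    #|star ends (inner B) v| = r - #|star ends (cut ends setT B) v|.
  by move=> vB; rewrite -(reg v) (card_star_inner vB) addnK.
have le1 v : #|star ends (cut ends setT B) v| <= 1.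
  apply: leq_trans cB; apply/subset_leq_card/subsetP=> e.
  by rewrite inE => /andP[].
apply: (@factor_of_cuts _ _ ends (inner B) B (fun=> kap) r kap om) => //.
- by move=> e; rewrite inE.
- move=> v vB; rewrite kap_even degE //=.
  by move: (le1 v) r_ge5 kap_le; clear; lia.
- by move=> v vB vom; rewrite degE // omP // subn0 mulnC.
- by rewrite degE //; move: (le1 om) r_ge5 kap_le; clear; nia.
- by rewrite degE //; move: (le1 om) r_ge5 kap_le; clear; nia.
(* Both [U] and [B :\: U] have at least two leaving edges and at most one edge leaves [B], so twice
   the inner cut is at least 3. *)
- move=> U UB Un0 UnB; rewrite ltnNge; apply/negP=> le_cut.
  have := cut_inner_split UB; have := leaf_min lB UB UnB Un0.
  have : 1 < #|cut ends setT (B :\: U)|.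
    apply: (leaf_min lB); first exact: subsetDl.
      apply: contra Un0 => /eqP/setDidPl; rewrite disjoint_sym => dUB.
      by rewrite -(setIidPl UB) setI_eq0.
    rewrite setD_eq0; apply: contra UnB => sBU.
    by rewrite eqEsubset UB.
  by move: le_cut cB; clear; lia.
Qed.

Let L := cover leaves.

Lemma leaf_subL B : leaf B -> B \subset L.
Proof. by move=> lB; apply: bigcup_sup; rewrite inE. Qed.

(* All leaves are contracted to the single vertex om: every low set contains a
   leaf, so the contracted graph has no cut of size at most 1. *)
Lemma outer_factor kap : ~~ odd kap -> 3 * kap <= 2 * r ->
  exists2 F : {set E}, {in F, forall e, ~~ (ends e \subset L)} &
    {in ~: L, forall v, #|star ends F v| = kap}.
Proof.
move=> kap_even kap_le.
have [LT|] := eqVneq L setT.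
  by exists set0 => [e|v]; rewrite ?LT !inE.
rewrite -subTset => /subsetPn[v1 _ v1L].
have [om omL] : exists om, om \in L.
  have /low_leaf[B lB _] : low setT.
    rewrite /low -card_gt0 cardsT (cardD1 v1) eq_card0 // => e.
    by rewrite inE setIT ends2 andbF.
  have /andP[/set0Pn[x xB] _] := leaf_low lB.
  by exists x; apply: subsetP xB; apply: leaf_subL.
pose pi x := if x \in L then om else x.
pose ends' e := pi @: ends e.
(* Edges inside [L] would become loops under the contraction [pi]. *)
pose D := [set e | ~~ (ends e \subset L)].
pose W := om |: ~: L.
have mem_ends' v e : v \notin L -> (v \in ends' e) = (v \in ends e).
  move=> vL; apply/imsetP/idP=> [[x xe]|ve]; rewrite /pi.
    by case: ifP => [_ vom|_ -> //]; rewrite vom omL in vL.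
  by exists v => //; rewrite (negPf vL).
have ends'E e x y : ends e = [set x; y] -> ends' e = [set pi x; pi y].
  by move=> exy; rewrite /ends' exy imsetU !imset_set1.
have ends'2 : {in D, forall e, #|ends' e| = 2}.
  move=> e; rewrite inE; have [x [y exy]] := endsE e.
  have := ends2 e; rewrite exy (ends'E _ _ _ exy) !cards2 subUset !sub1set negb_and.
  case: eqVneq => //= xy _; rewrite /pi.
  case: ifP => xL; case: ifP => yL //= _; case: eqVneq => // eq1.
  - by rewrite -eq1 omL in yL.
  - by rewrite eq1 omL in xL.
  - by rewrite eq1 eqxx in xy.
have ends'W : {in D, forall e, ends' e \subset W}.
  move=> e _; apply/subsetP=> _ /imsetP[x _ ->]; rewrite /pi !inE.
  by case: ifP => [|->]; rewrite ?eqxx ?orbT.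
have star' F v : v \notin L -> star ends' F v = star ends F v.
  by move=> vL; apply/setP=> e; rewrite !inE mem_ends'.
have degD v : v \notin L -> #|star ends' D v| = r.
  move=> vL; rewrite star' // -(reg v); apply: eq_card => e; rewrite !inE.
  case: (boolP (v \in ends e)) => ve; rewrite ?andbF ?andbT //.
  by apply/subsetPn; exists v.
have cut_out U : U \subset ~: L -> U != set0 -> 1 < #|cut ends' D U|.
  move=> /subsetP UL U0; rewrite ltnNge; apply/negP=> leU.
  have /low_leaf[B lB BU] : low U.
    rewrite /low U0; apply: leq_trans leU; apply/subset_leq_card/subsetP=> e.
    rewrite [_ \in cut _ _ _]inE in_setT => /= e1; rewrite inE.
    have -> : ends' e :&: U = ends e :&: U.
      apply/setP=> v; rewrite !inE; case: (boolP (v \in U)) => [vU|]; rewrite ?andbF //.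
      by rewrite !andbT mem_ends' //; have := UL v vU; rewrite inE.
    rewrite e1 andbT inE; have /cards1P[v ev] := e1.
    have /setIP[ve vU] : v \in ends e :&: U by rewrite ev set11.
    by apply/subsetPn; exists v => //; have := UL v vU; rewrite inE.
  have /andP[/set0Pn[x xB] _] := leaf_low lB.
  by have := UL x (subsetP BU x xB); rewrite inE (subsetP (leaf_subL lB)).
have cut_ge2 U : U \subset W -> U != set0 -> U != W -> 1 < #|cut ends' D U|.
  move=> UW U0 UnW; case: (boolP (om \in U)) => omU; last first.
    apply: cut_out U0; apply/subsetP=> x xU; have := subsetP UW x xU.
    by rewrite !inE; case: eqVneq => // xom; rewrite xom (negPf omU) in xU.
  (* Passing to the complement in [W] avoids the contracted vertex. *)
  have -> : cut ends' D U = cut ends' D (W :\: U).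
    apply/setP=> e; case: (boolP (e \in D)) => eD; last first.
      by rewrite !inE in eD *; rewrite (negPf eD).
    have [x [y exy]] := endsE e; have e'E := ends'E _ _ _ exy.
    rewrite !(mem_cut _ _ (ends'2 e eD) e'E).
    have := ends'W e eD; rewrite e'E subUset !sub1set !in_setD => /andP[-> ->].
    by rewrite !andbT; case: (pi x \in U); case: (pi y \in U).
  apply: cut_out.
    apply/subsetP=> x; rewrite !inE => /andP[xU]; case: eqVneq => // xom.
    by rewrite xom omU in xU.
  by rewrite setD_eq0; apply: contra UnW => WU; rewrite eqEsubset UW.
pose d := #|star ends' D om|.
have d_gt0 : 0 < d.
  have : 1 < #|cut ends' D [set om]|.
    apply: cut_ge2; rewrite ?sub1set ?setU11 // -?card_gt0 ?cards1 //.
    apply/eqP=> omW; have : v1 \in W by rewrite !inE v1L orbT.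
    by rewrite -omW inE => /eqP v1om; rewrite v1om omL in v1L.
  move=> /ltnW gt0; apply: leq_trans gt0 _; apply/subset_leq_card/subsetP=> e.
  rewrite !inE => /andP[-> /cards1P[x ex]].
  have : x \in ends' e :&: [set om] by rewrite ex set11.
  by rewrite !inE => /andP[xe /eqP <-].
(* The largest even value not above the fractional degree of [om]. *)
pose y := 2 * (kap * d %/ (2 * r)).
have y_le : r * y <= kap * d.
  by rewrite /y mulnA [r * 2]mulnC mulnC leq_divM.
have y_gt : kap * d < r * y + 2 * r.
  have : 0 < 2 * r by move: r_ge5; clear; lia.
  move/(ltn_ceil (kap * d)); rewrite /y mulSn; move: (_ %/ _) => q; clear; nia.
have [||||F FD Fdeg] := @factor_of_cuts _ _ ends' D W
    (fun v => if v == om then y else kap) r kap om ends'2 ends'W _ _ kap_le _ _ cut_ge2.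
- move=> v; rewrite in_setU1; case: eqVneq => [-> _|_ /= vL].
    rewrite /y oddM /= -/y -/d; move: kap_le y_le r_ge5 d_gt0; clear.
    by clearbody y d; nia.
  by rewrite inE in vL; rewrite degD // kap_even; move: kap_le r_ge5; clear; lia.
- move=> v; rewrite in_setU1; case: eqVneq => //= _ vL _.
  by rewrite inE in vL; rewrite degD // mulnC.
- by rewrite eqxx -/d; move: y_le r_ge5; clear; clearbody y d; lia.
- by rewrite eqxx -/d.
exists F => [e /(subsetP FD)|v]; rewrite inE // => vL.
have := Fdeg v; rewrite !inE vL orbT star' // => ->//.
by case: eqVneq => // vom; rewrite vom omL in vL.
Qed.

Lemma star_bigcup_leaf (F0 : {set E}) (G : {set V} -> {set E}) B v :
    {in F0, forall e, ~~ (ends e \subset L)} ->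
    (forall B, leaf B -> G B \subset inner B) -> leaf B -> v \in B ->
  #|star ends (F0 :|: \bigcup_(B in leaves) G B) v| =
  #|star ends F0 v| + #|star ends (G B) v|.
Proof.
move=> F0L GB lB vB.
have -> : star ends (F0 :|: \bigcup_(B in leaves) G B) v =
          star ends F0 v :|: star ends (G B) v.
  apply/setP=> e; rewrite in_setU ![_ \in star _ _ _]in_set in_setU -andb_orl.
  case: (boolP (v \in ends e)) => ve; rewrite ?andbF ?andbT //; congr (_ || _).
  apply/bigcupP/idP=> [[B' ]|eG]; last by exists B; rewrite ?inE.
  rewrite inE => lB' eG; have [<-//|BB'] := eqVneq B' B.
  have := subsetP (GB _ lB') e eG; rewrite inE => /subsetP/(_ v ve) vB'.
  by have /pred0P/(_ v) := leaf_disjoint lB' lB BB'; rewrite /= vB vB'.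
rewrite cardsU disjoint_setI0 ?cards0 ?subn0 //.
apply/pred0P=> e /=; apply/negP=> /andP[/setIdP[/F0L/negP eL _] /setIdP[eG _]].
case: eL; have := subsetP (GB B lB) e eG; rewrite inE => eB.
exact: subset_trans eB (leaf_subL lB).
Qed.

Lemma star_bigcup_outer (F0 : {set E}) (G : {set V} -> {set E}) v :
    (forall B, leaf B -> G B \subset inner B) -> v \notin L ->
  #|star ends (F0 :|: \bigcup_(B in leaves) G B) v| = #|star ends F0 v|.
Proof.
move=> GB vL; apply: eq_card => e; rewrite ![_ \in star _ _ _]in_set in_setU.
case: (boolP (v \in ends e)) => ve; rewrite ?andbF ?andbT //.
case: (e \in F0) => //=; apply/bigcupP=> -[B].
rewrite inE => lB /(subsetP (GB B lB)); rewrite inE => /subsetP/(_ v ve) vB.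
by rewrite (subsetP (leaf_subL lB)) in vL.
Qed.

(* In a leaf whose outgoing edge lies in F0 a k-factor is impossible by parity;
   the degrees k + 1 and k + 3 satisfy 3 (k + 1) = (k + 3) + 2 k, and they are
   odd, so that factors with these degrees are complements of even ones. *)
Lemma leaf_extend (F0 : {set E}) k B : odd r -> ~~ odd k -> k + 3 <= r ->
    3 * k <= 2 * r -> r <= 3 * k.+1 ->
    {in F0, forall e, ~~ (ends e \subset L)} -> leaf B ->
  exists F : {set E} * {set E},
    [/\ F.1 \subset inner B, F.2 \subset inner B &
    {in B, forall v, 3 * (#|star ends F0 v| + #|star ends F.1 v|) =
       #|star ends F0 v| + #|star ends F.2 v| + 2 * k}].
Proof.
move=> r_odd k_even k_lt k_le k_ge F0L lB.
have /andP[_ cB] := leaf_low lB.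
have starF0 v : v \in B -> star ends F0 v \subset star ends (cut ends setT B) v.
  move=> vB; apply/subsetP=> e; rewrite ![_ \in star _ _ _]in_set => /andP[eF ve].
  rewrite ve andbT; have [x [y exy]] := endsE e; rewrite (mem_cut _ _ (ends2 _) exy) in_setT /=.
  have : ~~ (ends e \subset B).
    by apply: contra (F0L e eF) => eB; apply: subset_trans eB (leaf_subL lB).
  move: ve; rewrite exy subUset !sub1set !inE => /orP[] /eqP <-; rewrite vB //=.
  by case: (x \in B).
have [F0c|[e0 /setIP[e0F e0B]]] := set_0Vmem (F0 :&: cut ends setT B).
  have [F FB Fdeg] := leaf_factor lB k_even k_le.
  exists (F, F); split=> // v vB /=; rewrite Fdeg //.
  have -> : star ends F0 v = set0.
    apply/eqP; rewrite -subset0; apply/subsetP=> e eF0.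
    rewrite -F0c; apply/setIP; split; first by case/setIdP: eF0.
    by have /setIdP[] := subsetP (starF0 v vB) e eF0.
  by rewrite cards0; clear; lia.
(* Take the complement in [B] of a factor of degree [r - (k + j)], which is even as [r] and [j] are
   odd and [k] is even. At the end of the leaving edge [e0], the edge itself, being in [F0],
   supplies the missing degree. *)
have compl j : odd j -> k + j <= r -> r <= 3 * (k + j) ->
    exists2 F : {set E}, F \subset inner B &
      {in B, forall v, #|star ends F0 v| + #|star ends F v| = k + j}.
  move=> j_odd lej gej; have [||F FB Fdeg] := @leaf_factor B (r - (k + j)) lB.
  - by move: r_odd k_even j_odd lej; clear; lia.
  - by move: lej gej; clear; lia.
  exists (inner B :\: F); first exact: subsetDl.
  move=> v vB.
  have -> : star ends (inner B :\: F) v = star ends (inner B) v :\: star ends F v.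
    apply/setP=> e; rewrite in_setD ![_ \in star _ _ _]in_set in_setD.
    by case: (v \in ends e); rewrite ?andbT ?andbF.
  have sFB : star ends F v \subset star ends (inner B) v.
    by apply/subsetP=> e /setIdP[/(subsetP FB) eB ve]; rewrite inE eB.
  have := card_star_inner vB; have := subset_leq_card sFB.
  rewrite reg cardsDS // Fdeg //.
  suff -> : star ends F0 v = star ends (cut ends setT B) v.
    by move: lej; clear; lia.
  apply/eqP; rewrite eqEsubset starF0 //; apply/subsetP=> e /setIdP[eB ve].
  by rewrite inE ve andbT; have -> : e = e0 by apply: (card_le1_eqP cB).
have [|||F1 F1B F1deg] := compl 1 => //; first by move: k_lt; clear; lia.
  by move: k_ge; clear; lia.
have [|||F3 F3B F3deg] := compl 3 => //; first by move: k_ge; clear; lia.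
exists (F1, F3); split=> // v vB /=; rewrite F1deg // F3deg //; clear; lia.
Qed.

(** Both sets extend the same [F0]; outside the leaves the identity is [3 * k = k + 2 * k], and
    [leaf_extend] settles each leaf separately. *)
Lemma flow_pair k : odd r -> ~~ odd k -> k + 3 <= r ->
    3 * k <= 2 * r -> r <= 3 * k.+1 ->
  exists F1 F3 : {set E},
    forall v, 3 * #|star ends F1 v| = #|star ends F3 v| + 2 * k.
Proof.
move=> r_odd k_even k_lt k_le k_ge.
have [F0 F0L F0deg] := outer_factor k_even k_le.
have /fin_all_exists[G GP] (B : {set V}) : exists F : {set E} * {set E}, leaf B ->
    [/\ F.1 \subset inner B, F.2 \subset inner B &
    {in B, forall v, 3 * (#|star ends F0 v| + #|star ends F.1 v|) =
       #|star ends F0 v| + #|star ends F.2 v| + 2 * k}].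
  case: (boolP (leaf B)) => [lB|]; last by exists (set0, set0).
  have [F FP] := leaf_extend r_odd k_even k_lt k_le k_ge F0L lB.
  by exists F.
have G1 B : leaf B -> (G B).1 \subset inner B by case/GP.
have G3 B : leaf B -> (G B).2 \subset inner B by case/GP.
exists (F0 :|: \bigcup_(B in leaves) (G B).1).
exists (F0 :|: \bigcup_(B in leaves) (G B).2) => v.
case: (boolP (v \in L)) => [/bigcupP[B]|vL].
  rewrite inE => lB vB; rewrite !(star_bigcup_leaf _ _ lB vB) //.
  by case: (GP B lB) => _ _; apply.
rewrite !star_bigcup_outer // F0deg ?inE //; clear; lia.
Qed.

End Cuts.

(** * Flows *)

(** Adding its parity to [r./2] makes it even. The bound [k + 3 <= r], which leaves room for degree
    [k + 3] in a leaf, is attained at [r = 5] and [r = 7]. *)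
Lemma even_near_half (r : nat) : 5 <= r -> odd r ->
  exists k, [/\ ~~ odd k, k + 3 <= r & 2 * k = r.+1 \/ 2 * k = r.-1].
Proof.
move=> r_ge5 r_odd; exists (r./2 + odd r./2); rewrite oddD.
by case: (boolP (odd r./2)) => oh /=; split; lia.
Qed.

Lemma sum_mem_star (V E : finType) (ends : E -> {set V}) (F : {set E}) v :
  (\sum_(e | v \in ends e) (e \in F)%:Z)%R = #|star ends F v|%:Z%R.
Proof.
rewrite -sum1_card (big_morph Posz PoszD (erefl _)).
rewrite [RHS](eq_bigl (fun e => (v \in ends e) && (e \in F))); last first.
  by move=> e; rewrite inE andbC.
by rewrite [RHS]big_mkcondr; apply: eq_bigr => e _; case: (e \in F).
Qed.

Lemma sum1_star (V E : finType) (ends : E -> {set V}) v :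
  (\sum_(e | v \in ends e) 1%:Z)%R = #|star ends setT v|%:Z%R.
Proof. by rewrite -sum_mem_star; apply: eq_bigr => e _; rewrite in_setT. Qed.

(** Deleting the cut of a low set [U] keeps the graph connected, yet [U] is closed under the
    remaining adjacency, so it is everything. *)
Lemma edge_connected2_leaf (G : graph) : edge_connected 2 G ->
  leaf (@ends G) setT.
Proof.
move=> [Vgt1 conn]; apply/minsetP; split.
  rewrite /low -card_gt0 cardsT ltnW //= eq_card0 // => e.
  by rewrite inE setIT card_ends andbF.
move=> U /andP[/set0Pn[x xU] leU] _; apply/setP=> y; rewrite in_setT.
rewrite -xU; symmetry.
apply: (@closed_connect _ (adj_del (cut (@ends G) setT U))) (conn _ leU x y).
move=> a b /existsP[e /andP[eU /eqP eab]].
move: eU; rewrite (mem_cut _ _ (card_ends e) eab) in_setT /= negbK.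
by move/eqP.
Qed.

Theorem theorem9 (r : nat) (hr : 5 <= r) (r_odd : odd r) :
  (forall G : graph, regular r G -> admits_sum_flow 1%:Z%R 3 G) /\
  (forall G : graph, regular r G -> edge_connected 2 G ->
     admits_sum_flow 1%:Z%R 2 G).
Proof.
have [k [k_even k3 k_half]] := even_near_half hr r_odd.
have k_le : 3 * k <= 2 * r by case: k_half; lia.
have k_ge : r <= 3 * k.+1 by case: k_half; lia.
pose s : int := (2 * k%:Z - r%:Z)%R.
have ss : (s * s = 1)%R by rewrite /s; case: k_half; nia.
have s1 : absz s = 1 by rewrite /s; case: k_half; lia.
have star_reg G : regular r G -> forall v, #|star (@ends G) setT v| = r.
  by move=> reg v; rewrite -(reg v); apply: eq_card => e; rewrite !inE.
split=> G reg.
  have [F1 [F3 F13]] := flow_pair (@card_ends G) hr (star_reg G reg) r_odd k_even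
    k3 k_le k_ge.
  (* The second factor takes only the values [-1], [-2], [2] and [1]; its sum at a vertex is
     [2 * k - r = s], and [s * s = 1]. *)
  exists (fun e => s * (3 * (e \in F1)%:Z - (e \in F3)%:Z - 1%:Z))%R; split=> [e|v].
    by rewrite abszM s1; case: (e \in F1); case: (e \in F3).
  rewrite -GRing.mulr_sumr !GRing.sumrB -GRing.mulr_sumr !sum_mem_star sum1_star.
  rewrite star_reg //; apply: etrans ss; congr (_ * _)%R.
  by have := F13 v; rewrite /s; lia.
move=> conn.
have [F _ Fdeg] := leaf_factor (@card_ends G) hr (star_reg G reg)
  (edge_connected2_leaf conn) k_even k_le.
exists (fun e => s * (2 * (e \in F)%:Z - 1%:Z))%R; split=> [e|v].
  by rewrite abszM s1; case: (e \in F).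
rewrite -GRing.mulr_sumr !GRing.sumrB -GRing.mulr_sumr !sum_mem_star sum1_star.
by rewrite star_reg // Fdeg ?inE.
Qed.
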